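(* Let $X_i,\bar X_i\in\mathbb{R}^{n_x\times T}$, $U_i\in\mathbb{R}^{n_u\times T}$, $Y_i\in\mathbb{R}^{n_y\times T}$ be data matrices collected from the (unknown) subsystem, let $Q_{wi}$ be the disturbance-bound matrix, and let $\Psi_i$ be the set of data-consistent parameters $(A_i,B_i,C_i)$ (all defined in the context, together with the two standing assumptions on disturbances and data richness). Suppose there are $\bar K_i\in\mathbb{R}^{n_u\times n_x}$, $\tilde K_i\in\mathbb{R}^{T\times n_x}$, a symmetric $\mathcal{X}_i=[\mathcal{X}_i^{kl}]_{k,l\in\{1,2\}}$ (with $\mathcal{X}_i^{11}\in\mathbb{R}^{n_x\times n_x}$, $\mathcal{X}_i^{22}\in\mathbb{R}^{n_y\times n_y}$) and $\lambda_i\in\mathbb{R}$ such that $X_i\tilde K_i$ is symmetric, $X_i\tilde K_i>0$, $\mathcal{X}_i^{11}>0$, $\mathcal{X}_i^{22}<0$, $\lambda_i\ge0$, $$Q_i>0\quad\text{and}\quad\begin{bmatrix}Q_i&S_i\\ S_i^\top&R_i\end{bmatrix}\ge0,$$ where $$Q_i=\begin{bmatrix}(-\mathcal{X}_i^{22})^{-1}&Y_i\tilde K_i&\mathbf{0}\\ \star&X_i\tilde K_i&\tilde K_i^\top Y_i^\top\mathcal{X}_i^{21}\\ \star&\star&\mathcal{X}_i^{11}\end{bmatrix},\quad S_i=\begin{bmatrix}\mathbf{0}&\mathbf{0}&\mathbf{0}\\ \mathbf{0}&X_i\tilde K_i&\bar K_i^\top\\ \mathbf{I}&\mathbf{0}&\mathbf{0}\end{bmatrix},$$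 $$R_i=\begin{bmatrix}X_i\tilde K_i&\mathbf{0}&\mathbf{0}\\ \mathbf{0}&\mathbf{0}&\mathbf{0}\\ \mathbf{0}&\mathbf{0}&\mathbf{0}\end{bmatrix}-\lambda_i\begin{bmatrix}\mathbf{I}&\bar X_i\\ \mathbf{0}&-X_i\\ \mathbf{0}&-U_i\end{bmatrix}Q_{wi}\begin{bmatrix}\mathbf{I}&\bar X_i\\ \mathbf{0}&-X_i\\ \mathbf{0}&-U_i\end{bmatrix}^\top .$$ Then, with $K_i=\bar K_i(X_i\tilde K_i)^{-1}$, for every $(A_i,B_i,C_i)\in\Psi_i$ the closed-loop subsystem $$x_i(t+1)=(A_i+B_iK_i)x_i(t)+\tilde u_i(t),\qquad y_i(t)=C_ix_i(t)$$ is $\mathcal{X}_i$-dissipative from $\tilde u_i$ to $y_i$.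
   Context: Data: a subsystem $x_i(t+1)=A_ix_i(t)+B_iu_i(t)+w_i(t)$, $y_i(t)=C_ix_i(t)$ with $x_i\in\mathbb{R}^{n_x}$, $u_i\in\mathbb{R}^{n_u}$, $y_i\in\mathbb{R}^{n_y}$ and unknown parameters produces a trajectory, from which one forms $X_i=[x_i(0),\dots,x_i(T-1)]$, $\bar X_i=[x_i(1),\dots,x_i(T)]$, $U_i=[u_i(0),\dots,u_i(T-1)]$, $Y_i=[y_i(0),\dots,y_i(T-1)]$ (known) and $W_i=[w_i(0),\dots,w_i(T-1)]$ (unknown). Disturbance assumption: $W_i$ satisfies $$\begin{bmatrix}\mathbf{I}\\ W_i^\top\end{bmatrix}^\top Q_{wi}\begin{bmatrix}\mathbf{I}\\ W_i^\top\end{bmatrix}\ge0 \qquad(\ast)$$ where $Q_{wi}=[Q_{wi}^{kl}]_{k,l\in\{1,2\}}\in\mathbb{R}^{(n_x+T)\times(n_x+T)}$ is a known symmetric matrix with $Q_{wi}^{22}<0$. Data-richness assumption: $\begin{bmatrix}U_i\\ X_i\end{bmatrix}$ has full row rank $n_u+n_x$. $\Psi_i$ is the set of all $(A_i,B_i,C_i)$ for which there exists some $W_i$ satisfying $(\ast)$ with $\bar X_i=A_iX_i+B_iU_i+W_i$ and $Y_i=C_iX_i$. Matrix inequalities are between symmetric matrices ($>0$ positive definite, $\ge0$ positive semidefinite); $\star$ denotes blocks determined by symmetry. Dissipativity: a discrete-time system $x(t+1)=f(x(t),u(t))$, $y(t)=h(x(t),u(t))$ is $\mathcal{X}$-dissipative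 from $u$ to $y$, where $\mathcal{X}=\mathcal{X}^\top=[\mathcal{X}^{kl}]_{k,l\in\{1,2\}}$, if there is a storage function $V$ of the state with $V(0)=0$, $V(x)>0$ for all $x\ne 0$, and $$V(x(t+1))-V(x(t))\le\begin{bmatrix}u(t)\\ y(t)\end{bmatrix}^\top\begin{bmatrix}\mathcal{X}^{11}&\mathcal{X}^{12}\\ \mathcal{X}^{21}&\mathcal{X}^{22}\end{bmatrix}\begin{bmatrix}u(t)\\ y(t)\end{bmatrix}$$ for all $t\in\{0,1,2,\dots\}$, all input sequences and all corresponding trajectories. *)

(* Defs.v *)
From HB Require Import structures.
From mathcomp Require Import all_boot all_order all_algebra.
From mathcomp Require Import reals.

Set Implicit Arguments.
Unset Strict Implicit.
Unset Printing Implicit Defensive.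

Import GRing.Theory.
Local Open Scope ring_scope.

(* Dimensions may be 0 throughout; definiteness is then vacuous. *)

Definition quad_form (R : realType) (n : nat) (M : 'M[R]_n) (v : 'cV[R]_n) : R :=
  (v^T *m M *m v) 0 0.

(* Matrix inequalities are only ever asserted between symmetric matrices, so
   symmetry is part of each of the three predicates below. *)
Definition posdef (R : realType) (n : nat) (M : 'M[R]_n) : Prop :=
  M^T = M /\ forall v : 'cV[R]_n, v != 0 -> 0 < quad_form M v.

Definition possemidef (R : realType) (n : nat) (M : 'M[R]_n) : Prop :=
  M^T = M /\ forall v : 'cV[R]_n, 0 <= quad_form M v.

Definition negdef (R : realType) (n : nat) (M : 'M[R]_n) : Prop :=
  M^T = M /\ forall v : 'cV[R]_n, v != 0 -> quad_form M v < 0.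

Definition block3_mx (R : realType) (m1 m2 m3 n1 n2 n3 : nat)
    (A11 : 'M[R]_(m1, n1)) (A12 : 'M[R]_(m1, n2)) (A13 : 'M[R]_(m1, n3))
    (A21 : 'M[R]_(m2, n1)) (A22 : 'M[R]_(m2, n2)) (A23 : 'M[R]_(m2, n3))
    (A31 : 'M[R]_(m3, n1)) (A32 : 'M[R]_(m3, n2)) (A33 : 'M[R]_(m3, n3)) :
    'M[R]_(m1 + (m2 + m3), n1 + (n2 + n3)) :=
  col_mx (row_mx A11 (row_mx A12 A13))
    (col_mx (row_mx A21 (row_mx A22 A23))
            (row_mx A31 (row_mx A32 A33))).

(* [s(0), ..., s(T-1)] *)
Definition samples (R : realType) (n T : nat) (s : nat -> 'cV[R]_n) :
    'M[R]_(n, T) :=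
  \matrix_(k < n, t < T) s t k 0.

Definition disturbance_bound (R : realType) (nx T : nat)
    (Qw : 'M[R]_(nx + T)) (W : 'M[R]_(nx, T)) : Prop :=
  let E := col_mx 1%:M W^T : 'M[R]_(nx + T, nx) in
  possemidef (E^T *m Qw *m E).

(* Membership of (A, B, C) in the set of data-consistent parameters. *)
Definition data_consistent (R : realType) (nx nu ny T : nat)
    (Qw : 'M[R]_(nx + T)) (X Xbar : 'M[R]_(nx, T)) (U : 'M[R]_(nu, T))
    (Y : 'M[R]_(ny, T))
    (A : 'M[R]_nx) (B : 'M[R]_(nx, nu)) (C : 'M[R]_(ny, nx)) : Prop :=
  exists W : 'M[R]_(nx, T),
    [/\ disturbance_bound Qw W, Xbar = A *m X + B *m U + W & Y = C *m X].

(* Dissipativity of x(t+1) = f (x t) (u t), y(t) = h (x t) (u t) from u to y,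
   with respect to the supply matrix XX. *)
Definition dissipative (R : realType) (n m p : nat) (XX : 'M[R]_(m + p))
    (f : 'cV[R]_n -> 'cV[R]_m -> 'cV[R]_n)
    (h : 'cV[R]_n -> 'cV[R]_m -> 'cV[R]_p) : Prop :=
  exists V : 'cV[R]_n -> R,
    [/\ V 0 = 0,
        (forall x, x != 0 -> 0 < V x)
      & forall (x : nat -> 'cV[R]_n) (u : nat -> 'cV[R]_m) (y : nat -> 'cV[R]_p),
          (forall t, x t.+1 = f (x t) (u t)) ->
          (forall t, y t = h (x t) (u t)) ->
          forall t, V (x t.+1) - V (x t) <= quad_form XX (col_mx (u t) (y t))].

Definition lmi_Q (R : realType) (nx ny T : nat)
    (X : 'M[R]_(nx, T)) (Y : 'M[R]_(ny, T)) (Kt : 'M[R]_(T, nx))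
    (XX : 'M[R]_(nx + ny)) : 'M[R]_(ny + (nx + nx)) :=
  let XX11 := ulsubmx XX in
  let XX21 := dlsubmx XX in
  let XX22 := drsubmx XX in
  block3_mx
    (invmx (- XX22)) (Y *m Kt)                   0
    (Y *m Kt)^T      (X *m Kt)                   (Kt^T *m Y^T *m XX21)
    0                (Kt^T *m Y^T *m XX21)^T     XX11.

Definition lmi_S (R : realType) (nx nu ny T : nat)
    (X : 'M[R]_(nx, T)) (Kbar : 'M[R]_(nu, nx)) (Kt : 'M[R]_(T, nx)) :
    'M[R]_(ny + (nx + nx), nx + (nx + nu)) :=
  block3_mx
    0    0          0
    0    (X *m Kt)  Kbar^T
    1%:M 0          0.

Definition lmi_R (R : realType) (nx nu T : nat) (Qw : 'M[R]_(nx + T))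
    (X Xbar : 'M[R]_(nx, T)) (U : 'M[R]_(nu, T)) (Kt : 'M[R]_(T, nx))
    (lambda : R) : 'M[R]_(nx + (nx + nu)) :=
  let N : 'M[R]_(nx + (nx + nu), nx + T) :=
    col_mx (row_mx 1%:M Xbar) (col_mx (row_mx 0 (- X)) (row_mx 0 (- U))) in
  block3_mx
    (X *m Kt) 0 0
    0         0 0
    0         0 0
  - lambda *: (N *m Qw *m N^T).

(* Main.v *)
Require Import Defs.
From HB Require Import structures.
From mathcomp Require Import all_boot all_order all_algebra.
From mathcomp Require Import reals ring lra.

Set Implicit Arguments.
Unset Strict Implicit.
Unset Printing Implicit Defensive.

Import Order.TTheory GRing.Theory Num.Theory.
Local Open Scope ring_scope.

(* With P = X Kt, the storage function is V(x) = x^T P^-1 x.  Data consistency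
   gives N^T [I; A^T; B^T] = [I; W^T], N being the left factor in [lmi_R], so
   restricting the second block of the big LMI to the range of [I; A^T; B^T]
   removes the unknown disturbance, bounds the lower right block by P, and
   leaves a nonnegative form in (v1, v2, v3, z).
   Evaluated at (XX22 C x, P^-1 x, u, - P^-1 x+), where x+ = (A + B K) x + u,
   that form is exactly the supply rate minus V(x+) - V(x). *)

Lemma quad_form_conj (R : realType) (m n : nat) (M : 'M[R]_m) (G : 'M[R]_(m, n))
    (z : 'cV[R]_n) :
  quad_form M (G *m z) = quad_form (G^T *m M *m G) z.
Proof. by rewrite /quad_form trmx_mul !mulmxA. Qed.

Lemma quad_form_block (R : realType) (m n : nat) (M11 : 'M[R]_m)
    (M12 : 'M[R]_(m, n)) (M22 : 'M[R]_n) (v : 'cV[R]_m) (w : 'cV[R]_n) :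
  quad_form (block_mx M11 M12 M12^T M22) (col_mx v w) =
  quad_form M11 v + (v^T *m M12 *m w) 0 0 *+ 2 + quad_form M22 w.
Proof.
have tr12 : (w^T *m M12^T *m v) 0 0 = (v^T *m M12 *m w) 0 0.
  have -> : w^T *m M12^T *m v = (v^T *m M12 *m w)^T.
    by rewrite !trmx_mul trmxK mulmxA.
  by rewrite [LHS]mxE.
rewrite /quad_form tr_col_mx mul_row_block mul_row_col !mulmxDl.
by rewrite [LHS]mxE 2![(_ + _ : 'M_1) 0 0]mxE tr12 mulr2n !addrA.
Qed.

Lemma quad_form_block3 (R : realType) (m n p : nat) (A11 : 'M[R]_m)
    (A12 : 'M[R]_(m, n)) (A13 : 'M[R]_(m, p)) (A22 : 'M[R]_n)
    (A23 : 'M[R]_(n, p)) (A33 : 'M[R]_p)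
    (v1 : 'cV[R]_m) (v2 : 'cV[R]_n) (v3 : 'cV[R]_p) :
  quad_form (block3_mx A11 A12 A13 A12^T A22 A23 A13^T A23^T A33)
    (col_mx v1 (col_mx v2 v3)) =
  quad_form A11 v1 + quad_form A22 v2 + quad_form A33 v3 +
  ((v1^T *m A12 *m v2) 0 0 + (v1^T *m A13 *m v3) 0 0 +
   (v2^T *m A23 *m v3) 0 0) *+ 2.
Proof.
(* Grouping the last two block rows and columns allows the two-block expansion to be used twice. *)
have -> : block3_mx A11 A12 A13 A12^T A22 A23 A13^T A23^T A33 =
    block_mx A11 (row_mx A12 A13) (row_mx A12 A13)^T (block_mx A22 A23 A23^T A33).
  by rewrite tr_row_mx /block_mx -block_mxEh.
rewrite !quad_form_block -mulmxA mul_row_col mulmxDr !mulmxA.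
rewrite [(_ + _ : 'M_1) 0 0]mxE; ring.
Qed.

(** A nonzero row in the kernel of [M^T] transposes to a nonzero [v] with [M v = 0], where the form
    would vanish. *)
Lemma quad_form_neq0_unitmx (R : realType) (n : nat) (M : 'M[R]_n) :
  (forall v : 'cV[R]_n, v != 0 -> quad_form M v != 0) -> M \in unitmx.
Proof.
move=> M_neq0; rewrite -unitmx_tr -row_free_unit -kermx_eq0.
apply/eqP/row_matrixP => i; rewrite row0; apply/eqP; apply/negP => /negP r_neq0.
have Mr : M *m (row i (kermx M^T))^T = 0.
  by apply: trmx_inj; rewrite trmx_mul trmxK -row_mul mulmx_ker row0 trmx0.
have /M_neq0/negP[] : (row i (kermx M^T))^T != 0 by rewrite trmx_eq0.
by rewrite /quad_form -mulmxA Mr mulmx0 mxE.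
Qed.

Lemma posdef_unitmx (R : realType) (n : nat) (M : 'M[R]_n) :
  posdef M -> M \in unitmx.
Proof.
by case=> _ M_gt0; apply: quad_form_neq0_unitmx => v /M_gt0; rewrite lt0r => /andP[].
Qed.

Lemma negdef_unitmx (R : realType) (n : nat) (M : 'M[R]_n) :
  negdef M -> M \in unitmx.
Proof.
by case=> _ M_lt0; apply: quad_form_neq0_unitmx => v /M_lt0; rewrite lt_neqAle => /andP[].
Qed.

Lemma quad_form_invmx (R : realType) (n : nat) (M : 'M[R]_n) (v : 'cV[R]_n) :
  M^T = M -> M \in unitmx -> quad_form (invmx M) v = quad_form M (invmx M *m v).
Proof. by move=> MT Mu; rewrite quad_form_conj trmx_inv MT mulVmx // mul1mx. Qed.

(** The term subtracted in [lmi_R] becomes [lambda] times the nonnegative form of the disturbance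
    bound, and the identity on top of [[I; A^T; B^T]] retains exactly [X Kt]. *)
Lemma data_consistent_bound (R : realType) (nx nu ny T : nat)
    (Qw : 'M[R]_(nx + T)) (X Xbar : 'M[R]_(nx, T)) (U : 'M[R]_(nu, T))
    (Y : 'M[R]_(ny, T)) (Kt : 'M[R]_(T, nx)) (lambda : R)
    (A : 'M[R]_nx) (B : 'M[R]_(nx, nu)) (C : 'M[R]_(ny, nx)) (z : 'cV[R]_nx) :
  0 <= lambda -> data_consistent Qw X Xbar U Y A B C ->
  quad_form (lmi_R Qw X Xbar U Kt lambda) (col_mx 1%:M (col_mx A^T B^T) *m z) <=
  quad_form (X *m Kt) z.
Proof.
move=> lambda_ge0 [W [[_ W_ge0] XbarE _]].
rewrite /lmi_R; set N := col_mx (row_mx 1%:M _) _; set G := col_mx _ _.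
have NG : N^T *m G = col_mx 1%:M W^T.
  rewrite !tr_col_mx !tr_row_mx !mul_row_col !mul_col_mx.
  rewrite !trmx1 !trmx0 !mul0mx !mul1mx mulmx1 !add_col_mx !addr0.
  (* The lower block is [Xbar^T - X^T A^T - U^T B^T], that is, [W^T]. *)
  congr col_mx; rewrite XbarE !linearD /= !linearN /= !trmx_mul !mulNmx.
  by rewrite -opprD addrC addKr.
rewrite quad_form_conj mulmxBr mulmxBl.
have -> : G^T *m (lambda *: (N *m Qw *m N^T)) *m G =
    lambda *: ((col_mx 1%:M W^T)^T *m Qw *m col_mx 1%:M W^T).
  by rewrite -NG trmx_mul trmxK -scalemxAr -scalemxAl !mulmxA.
have -> : G^T *m block3_mx (X *m Kt) 0 0 0 0 0 0 0 0 *m G = X *m Kt.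
  rewrite /block3_mx !row_mx0 !col_mx0 tr_col_mx mul_row_col.
  by rewrite trmx1 mulmx0 mul1mx addr0 mul_row_col mul0mx mulmx1 addr0.
rewrite {1}/quad_form mulmxBr mulmxBl -scalemxAr -scalemxAl [leLHS]mxE.
rewrite [(- _ : 'M_1) 0 0]mxE [(lambda *: _ : 'M_1) 0 0]mxE.
by rewrite gerBl mulr_ge0 // W_ge0.
Qed.

(** The gain formula enters here: with [P = X Kt] symmetric and [K = Kbar P^-1], one has
    [P K^T = Kbar^T], so [P A^T + Kbar^T B^T = P (A + B K)^T]. *)
Lemma lmi_S_closed_loop (R : realType) (nx nu ny T : nat)
    (X : 'M[R]_(nx, T)) (Kbar : 'M[R]_(nu, nx)) (Kt : 'M[R]_(T, nx))
    (A : 'M[R]_nx) (B : 'M[R]_(nx, nu)) :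
  (X *m Kt)^T = X *m Kt -> X *m Kt \in unitmx ->
  lmi_S ny X Kbar Kt *m col_mx 1%:M (col_mx A^T B^T) =
  col_mx 0 (col_mx (X *m Kt *m (A + B *m (Kbar *m invmx (X *m Kt)))^T) 1%:M).
Proof.
move=> PT Pu; rewrite /lmi_S /block3_mx !mul_col_mx !mul_row_col.
rewrite !mul0mx !add0r mul1mx !addr0.
congr (col_mx _ (col_mx _ _)).
by rewrite linearD /= !trmx_mul trmx_inv PT mulmxDr !mulmxA mulmxV // mul1mx.
Qed.

Theorem proposition6 (R : realType) (nx nu ny T : nat)
  (* the unknown subsystem and the trajectory it produced *)
  (A0 : 'M[R]_nx) (B0 : 'M[R]_(nx, nu)) (C0 : 'M[R]_(ny, nx))
  (x w : nat -> 'cV[R]_nx) (u : nat -> 'cV[R]_nu) (y : nat -> 'cV[R]_ny)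
  (Hx : forall t, (t < T)%N -> x t.+1 = A0 *m x t + B0 *m u t + w t)
  (Hy : forall t, (t < T)%N -> y t = C0 *m x t)
  (* the data matrices *)
  (X Xbar : 'M[R]_(nx, T)) (U : 'M[R]_(nu, T)) (Y : 'M[R]_(ny, T))
  (HX : X = samples T x) (HXbar : Xbar = samples T (fun t => x t.+1))
  (HU : U = samples T u) (HY : Y = samples T y)
  (* disturbance assumption *)
  (Qw : 'M[R]_(nx + T)) (HQw : Qw^T = Qw) (HQw22 : negdef (drsubmx Qw))
  (HW : disturbance_bound Qw (samples T w))
  (* data richness *)
  (Hrich : \rank (col_mx U X) = (nu + nx)%N)
  (* the design variables and matrix inequalities *)
  (Kbar : 'M[R]_(nu, nx)) (Kt : 'M[R]_(T, nx)) (XX : 'M[R]_(nx + ny))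
  (lambda : R)
  (HXX : XX^T = XX)
  (HXKsym : (X *m Kt)^T = X *m Kt) (HXK : posdef (X *m Kt))
  (HXX11 : posdef (ulsubmx XX)) (HXX22 : negdef (drsubmx XX))
  (Hlambda : 0 <= lambda)
  (HQ : posdef (lmi_Q X Y Kt XX))
  (HLMI : possemidef
     (block_mx (lmi_Q X Y Kt XX)        (lmi_S ny X Kbar Kt)
               (lmi_S ny X Kbar Kt)^T   (lmi_R Qw X Xbar U Kt lambda))) :
  let K := Kbar *m invmx (X *m Kt) in
  forall (A : 'M[R]_nx) (B : 'M[R]_(nx, nu)) (C : 'M[R]_(ny, nx)),
    data_consistent Qw X Xbar U Y A B C ->
    dissipative XX
      (fun (xt ut : 'cV[R]_nx) => (A + B *m K) *m xt + ut)
      (fun (xt ut : 'cV[R]_nx) => C *m xt).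
Proof.
move=> K A B C ABC.
set P := X *m Kt in HXKsym HXK K *.
have Pu := posdef_unitmx HXK.
have XX22u := negdef_unitmx HXX22.
have YKt : Y *m Kt = C *m P by case: ABC => W [_ _ ->]; rewrite -mulmxA.
exists (quad_form (invmx P)); split.
- by rewrite /quad_form mulmx0 mxE.
- move=> v v_neq0; rewrite quad_form_invmx //; apply: HXK.2.
  by apply: contraNneq v_neq0 => Pv0; rewrite -[v](mulKVmx Pu) Pv0 mulmx0.
(* From here on [x], [u], [y] denote an arbitrary closed-loop trajectory, soon reduced to a single
   step from [x] to [xp]. *)
move=> {Hx Hy HX HXbar HU HY HW} {}x {}u {}y xS yE t.
rewrite {}xS {}yE; move: (x t) (u t) => {x u y w t} x u.
set M := A + B *m K; set xp := M *m x + u.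
(* Both [q] and [z] are Schur complement minimizers: [q] of [q^T (-XX22)^-1 q + 2 q^T C x], [z] of
   [z^T P z + 2 xp^T z]. *)
set p := invmx P *m x; set z := - (invmx P *m xp).
set q := drsubmx XX *m (C *m x).
have Pp : P *m p = x by rewrite mulKVmx.
set G := col_mx 1%:M (col_mx A^T B^T).
have := HLMI.2 (col_mx (col_mx q (col_mx p u)) (G *m z)).
rewrite quad_form_block.
have -> : quad_form (lmi_Q X Y Kt XX) (col_mx q (col_mx p u)) =
    quad_form (drsubmx XX) (C *m x) + quad_form (invmx P) x +
    quad_form (ulsubmx XX) u + ((C *m x)^T *m dlsubmx XX *m u) 0 0 *+ 2.
  (* The bottom left zero block is written as [0^T] to match [quad_form_block3]. *)
  rewrite /lmi_Q -/P -[X in block3_mx _ _ _ _ _ _ X]trmx0 quad_form_block3.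
  (* This block gives minus the output term of the supply rate; the cross term with [Y Kt] gives it
     twice, so one copy remains. *)
  have -> : quad_form (invmx (- drsubmx XX)) q = - quad_form (drsubmx XX) (C *m x).
    rewrite [LHS]quad_form_conj HXX22.1.
    rewrite -[X in X *m _ *m _]opprK mulNmx mulmxV; last first.
      by rewrite -scaleN1r unitmxZ // unitrN1.
    rewrite mulNmx mul1mx.
    by rewrite /quad_form mulmxN mulNmx [LHS]mxE.
  have -> : q^T *m (Y *m Kt) *m p = (C *m x)^T *m drsubmx XX *m (C *m x).
    by rewrite trmx_mul HXX22.1 YKt -[LHS]mulmxA -mulmxA Pp.
  have -> : p^T *m (Kt^T *m Y^T *m dlsubmx XX) *m u = (C *m x)^T *m dlsubmx XX *m u.
    by rewrite -trmx_mul YKt [p^T *m _]mulmxA -trmx_mul -[C *m P *m p]mulmxA Pp.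
  rewrite -(quad_form_invmx x HXKsym Pu) mulmx0 mul0mx [(0 : 'M_1) 0 0]mxE.
  rewrite /quad_form; ring.
have -> : ((col_mx q (col_mx p u))^T *m lmi_S ny X Kbar Kt *m (G *m z)) 0 0 =
    - quad_form (invmx P) xp.
  rewrite -mulmxA [lmi_S _ _ _ _ *m _]mulmxA lmi_S_closed_loop // -/P -/K -/M.
  rewrite mul_col_mx mul0mx mul_col_mx mul1mx !tr_col_mx !mul_row_col mulmx0 add0r.
  have -> : p^T *m (P *m M^T *m z) = (M *m x)^T *m z.
    rewrite -[P *m _ *m z]mulmxA [p^T *m _]mulmxA -[P in p^T *m P]HXKsym.
    by rewrite -trmx_mul Pp mulmxA -trmx_mul.
  rewrite -mulmxDl -linearD /= -/xp.
  by rewrite /quad_form mulmxN [LHS]mxE mulmxA.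
have := data_consistent_bound Kt z Hlambda ABC; rewrite -/G -/P.
have -> : quad_form P z = quad_form (invmx P) xp.
  by rewrite quad_form_invmx // /quad_form /z [(- _)^T]linearN /= !mulNmx mulmxN opprK.
(* Symmetry expresses the upper right block through [XX21], the block occurring in [lmi_Q]. *)
have XXE : XX = block_mx (ulsubmx XX) (dlsubmx XX)^T (dlsubmx XX)^T^T (drsubmx XX).
  by rewrite trmxK trmx_dlsub HXX submxK.
have -> : quad_form XX (col_mx u (C *m x)) = quad_form (ulsubmx XX) u +
    ((C *m x)^T *m dlsubmx XX *m u) 0 0 *+ 2 + quad_form (drsubmx XX) (C *m x).
  rewrite {1}XXE quad_form_block.
  have -> : u^T *m (dlsubmx XX)^T *m (C *m x) = ((C *m x)^T *m dlsubmx XX *m u)^T.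
    by rewrite !trmx_mul !trmxK -!mulmxA.
  by rewrite [(_^T : 'M_1) 0 0]mxE.
(* The LMI now reads [0 <= supply + V(x) - 2 V(xp) + r], where [r], the [lmi_R] term, is at most
   [V(xp)]. *)
lra.
Qed.
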